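(* Let $n>5$ and let $\mathcal{A}$ be an $n$-dimensional complex naturally graded $2$-filiform non-split associative algebra of type $\mu(1,2)$. Then $\mathcal{A}$ is isomorphic to the algebra $\mu_{2,1}^n$ with basis $\{e_1,\dots,e_n\}$ and multiplication \[\mu_{2,1}^n:\left\{\begin{array}{ll} e_ie_j=e_{i+j}, & i,j\ge 1,\ 2\le i+j\le n-2,\\ e_{n-1}e_1=e_n, & \end{array}\right.\] where omitted products of basis elements vanish.
   Context: Associative algebras are not assumed to be unital. For an algebra $\mathcal{A}$ put $\mathcal{A}^1=\mathcal{A}$ and $\mathcal{A}^{i+1}=\sum_{k=1}^{i}\mathcal{A}^k\mathcal{A}^{i+1-k}$ for $i\ge 1$ (linear spans of products); $\mathcal{A}$ is nilpotent if $\mathcal{A}^i=0$ for some $i$. All algebras considered here are nilpotent. For a nilpotent associative algebra $\mathcal{A}$ put $\mathcal{A}_i=\mathcal{A}^i/\mathcal{A}^{i+1}$ and $\operatorname{gr}\mathcal{A}=\bigoplus_{i\ge 1}\mathcal{A}_i$, a graded algebra with the induced product $\mathcal{A}_i\mathcal{A}_j\subseteq\mathcal{A}_{i+j}$. $\mathcal{A}$ is called naturally graded if $\operatorname{gr}\mathcal{A}\cong\mathcal{A}$ as algebras; in that case $\mathcal{A}$ is identified with $\operatorname{gr}\mathcal{A}=\bigoplus_i\mathcal{A}_i$. For $x\in\mathcal{A}\setminus\mathcal{A}^2$ let $L_x:\mathcal{A}\to\mathcal{A}$, $z\mapsto xz$, and let $C(x)=(n_1,n_2,\dots,n_k)$ be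 the decreasing sequence of sizes of the Jordan blocks of the nilpotent operator $L_x$. Such sequences are ordered lexicographically. The characteristic sequence of $\mathcal{A}$ is $C(\mathcal{A})=\max_{x\in\mathcal{A}\setminus\mathcal{A}^2}C(x)$. An $n$-dimensional algebra $\mathcal{A}$ is $2$-filiform if $C(\mathcal{A})=(n-2,1,1)$. A naturally graded $2$-filiform algebra $\mathcal{A}=\bigoplus_i\mathcal{A}_i$ of dimension $n$ is said to be of type $\mu(t_1,t_2)$, with $1\le t_1\le t_2$, if it has a homogeneous basis $\{e_1,\dots,e_{n-2},f_1,f_2\}$ with $e_i\in\mathcal{A}_i$ for $1\le i\le n-2$, $f_1\in\mathcal{A}_{t_1}$, $f_2\in\mathcal{A}_{t_2}$, such that $e_ie_j=e_{i+j}$ for $i,j\ge1$, $2\le i+j\le n-2$, $e_ie_j=0$ for $i+j>n-2$, and $e_kf_s=0$ for $1\le k\le n-2$, $1\le s\le 2$. Non-split means not isomorphic to a direct sum of two nonzero algebras (ideals). *)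

(* Defs.v *)
From HB Require Import structures.
From mathcomp Require Import all_boot all_order all_algebra.
From mathcomp Require Import zify.
From mathcomp Require Import reals complex.

Set Implicit Arguments.
Unset Strict Implicit.
Unset Printing Implicit Defensive.

Import GRing.Theory.
Local Open Scope ring_scope.

Record assocAlg (K : fieldType) := AssocAlg {
  alg_sort :> vectType K;
  alg_mul : {bilinear alg_sort -> alg_sort -> alg_sort};
  alg_mulA : associative alg_mul
}.

Declare Scope alg_scope.
Delimit Scope alg_scope with alg.
Notation "x ** y" := (alg_mul _ x y)
  (at level 40, left associativity) : alg_scope.
Local Open Scope alg_scope.

Definition alg_iso (K : fieldType) (A B : assocAlg K) : Prop :=
  exists f : {linear A -> B},
    bijective f /\ forall x y : A, f (x ** y) = f x ** f y.

Section Powers.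
Variables (K : fieldType) (A : assocAlg K).
Implicit Types U V W : {vspace A}.

Definition alg_prodv U V : {vspace A} :=
  <<[seq u ** v | u <- vbasis U, v <- vbasis V]>>%VS.

Lemma alg_prodvP U V W :
  reflect (forall u v, u \in U -> v \in V -> u ** v \in W)
          (alg_prodv U V <= W)%VS.
Proof.
apply: (iffP idP) => [/subvP sUVW u v Uu Vv|sUVW]; last first.
  apply/span_subvP => _ /allpairsP[[u v] /= [Uu Vv ->]].
  by apply: sUVW; apply: vbasis_mem.
apply: sUVW; rewrite (coord_vbasis Uu) (coord_vbasis Vv).
rewrite linear_sumlz; apply: memv_suml => i _.
rewrite linear_sumr; apply: memv_suml => j _.
rewrite linearZl_LR linearZr_LR; do 2!apply: memvZ.
by apply/memv_span/allpairs_f; rewrite memt_nth.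
Qed.

Lemma memv_alg_mul U V u v :
  u \in U -> v \in V -> u ** v \in alg_prodv U V.
Proof. by move=> Uu Vv; have /alg_prodvP := subvv (alg_prodv U V); apply. Qed.

(* alg_pows m = [:: A^1; ...; A^m] *)
Fixpoint alg_pows (m : nat) : seq {vspace A} :=
  if m is m'.+1 then
    let s := alg_pows m' in
    rcons s (if m' is 0 then fullv else
      (\sum_(k < m') alg_prodv (nth fullv s k) (nth fullv s (m'.-1 - k)))%VS)
  else [::].

(* The value at i = 0 is a dummy. *)
Definition alg_pow (i : nat) : {vspace A} := nth fullv (alg_pows i) i.-1.

Lemma size_alg_pows m : size (alg_pows m) = m.
Proof. by elim: m => //= m IHm; rewrite size_rcons IHm. Qed.

Lemma nth_alg_pows m i : (i < m)%N -> nth fullv (alg_pows m) i = alg_pow i.+1.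
Proof.
elim: m => // m IHm; rewrite ltnS leq_eqVlt => /predU1P[-> //|lt_im].
by rewrite /= nth_rcons size_alg_pows lt_im IHm.
Qed.

Lemma alg_pow1 : alg_pow 1 = fullv. Proof. by []. Qed.

Lemma alg_powS i : (0 < i)%N ->
  alg_pow i.+1 =
    (\sum_(1 <= k < i.+1) alg_prodv (alg_pow k) (alg_pow (i.+1 - k)))%VS.
Proof.
case: i => // i _; rewrite {1}/alg_pow [alg_pows i.+2]/=.
rewrite nth_rcons -/(alg_pows i.+1) size_alg_pows ltnn eqxx.
rewrite big_add1 /= big_mkord; apply: eq_bigr => k _.
rewrite !(@nth_alg_pows i.+1) ?ltn_ord ?ltnS ?leq_subr //.
by rewrite subSS subSn // -ltnS.
Qed.

Lemma alg_powM i j u v : (0 < i)%N -> (0 < j)%N ->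
  u \in alg_pow i -> v \in alg_pow j -> u ** v \in alg_pow (i + j).
Proof.
case: j => // j i0 _ Au Av.
rewrite addnS alg_powS ?addn_gt0 ?i0 //.
have: u ** v \in alg_prodv (alg_pow i) (alg_pow ((i + j).+1 - i)).
  by rewrite -addnS addKn memv_alg_mul.
apply/subvP; rewrite (big_cat_nat _ (n := i)) //=; last by rewrite -addnS leq_addr.
rewrite (@big_ltn _ _ _ i) ?ltnS ?leq_addr //.
exact: subv_trans (addvSl _ _) (addvSr _ _).
Qed.

Definition alg_nilpotent : Prop :=
  exists i : nat, (0 < i)%N /\ alg_pow i = 0%VS.

End Powers.

Section DirectSum.
Variables (K : fieldType) (n : nat) (T : 'I_n -> vectType K).

Definition dirsum := {dffun forall i : 'I_n, T i}.
Implicit Types f g h : dirsum.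

Definition dirsum_of (F : forall i, T i) : dirsum := finfun F.
Lemma dirsumE F i : dirsum_of F i = F i. Proof. exact: ffunE. Qed.
Lemma dirsumP f g : (forall i, f i = g i) <-> f = g.
Proof. by split=> [/ffunP|->]. Qed.

HB.instance Definition _ := Choice.on dirsum.

Definition dirsum_add f g : dirsum := dirsum_of (fun i => f i + g i).
Definition dirsum_opp f : dirsum := dirsum_of (fun i => - f i).
Definition dirsum_scale (a : K) f : dirsum := dirsum_of (fun i => a *: f i).

Fact dirsum_addA : associative dirsum_add.
Proof. by move=> f g h; apply/dirsumP => i; rewrite !dirsumE addrA. Qed.
Fact dirsum_addC : commutative dirsum_add.
Proof. by move=> f g; apply/dirsumP => i; rewrite !dirsumE addrC. Qed.
Fact dirsum_add0 : left_id (dirsum_of (fun=> 0)) dirsum_add.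
Proof. by move=> f; apply/dirsumP => i; rewrite !dirsumE add0r. Qed.
Fact dirsum_addN : left_inverse (dirsum_of (fun=> 0)) dirsum_opp dirsum_add.
Proof. by move=> f; apply/dirsumP => i; rewrite !dirsumE addNr. Qed.

HB.instance Definition _ := GRing.isZmodule.Build dirsum
  dirsum_addA dirsum_addC dirsum_add0 dirsum_addN.

Fact dirsum_scaleA a b f :
  dirsum_scale a (dirsum_scale b f) = dirsum_scale (a * b) f.
Proof. by apply/dirsumP => i; rewrite !dirsumE scalerA. Qed.
Fact dirsum_scale1 : left_id 1 dirsum_scale.
Proof. by move=> f; apply/dirsumP => i; rewrite !dirsumE scale1r. Qed.
Fact dirsum_scaleDr : right_distributive dirsum_scale +%R.
Proof. by move=> a f g; apply/dirsumP => i; rewrite !dirsumE scalerDr. Qed.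
Fact dirsum_scaleDl f : {morph dirsum_scale^~ f : a b / a + b}.
Proof. by move=> a b; apply/dirsumP => i; rewrite !dirsumE scalerDl. Qed.

HB.instance Definition _ := GRing.Zmodule_isLmodule.Build K dirsum
  dirsum_scaleA dirsum_scale1 dirsum_scaleDr dirsum_scaleDl.

Lemma dirsum0E i : (0 : dirsum) i = 0. Proof. exact: dirsumE. Qed.
Lemma dirsumDE f g i : (f + g) i = f i + g i. Proof. exact: dirsumE. Qed.
Lemma dirsumZE a f i : (a *: f) i = a *: f i. Proof. exact: dirsumE. Qed.

Import VectorInternalTheory.

Fact dirsum_vect_iso : Vector.axiom (\sum_(i < n) dim (T i)) dirsum.
Proof.
exists (fun f => \mxrow_(i < n) v2r (f i)).
  by move=> a f g; apply/rowP => j; rewrite !mxE dirsumDE dirsumZE linearP !mxE.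
exists (fun r => dirsum_of (fun i => r2v (submxrow r i))) => [f|r].
  by apply/dirsumP => i; rewrite dirsumE mxrowK v2rK.
by apply/mxrowP => i; rewrite mxrowK dirsumE r2vK.
Qed.

HB.instance Definition _ := Lmodule_hasFinDim.Build K dirsum dirsum_vect_iso.

End DirectSum.

Section Graded.
Variables (K : fieldType) (A : assocAlg K).

(* The quotient A_i = A^i / A^(i+1), each class being represented by its unique
   member in a fixed complement of A^(i+1) in A^i; vsval is the representative,
   and gr_class i, meaningful on A^i, is the quotient map. *)
Definition gr_piece (i : nat) : vectType K :=
  subvs_of (alg_pow A i :\: alg_pow A i.+1)%VS.

Definition gr_class (i : nat) (z : A) : gr_piece i :=
  vsproj _ (addv_pi1 (alg_pow A i) (alg_pow A i.+1) z).

Fact gr_class_is_linear i : linear (gr_class i).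
Proof. by move=> a x y; rewrite /gr_class !linearP. Qed.
HB.instance Definition _ i := GRing.isLinear.Build K A (gr_piece i) _
  (gr_class i) (gr_class_is_linear i).

Lemma gr_piece_mem i (u : gr_piece i) : vsval u \in alg_pow A i.
Proof. exact: subvP (diffvSl _ _) _ (subvsP u). Qed.

Lemma vsval_gr_class i z : z \in alg_pow A i ->
  z - vsval (gr_class i z) \in alg_pow A i.+1.
Proof.
move=> Az; rewrite /gr_class vsprojK ?memv_pi //.
rewrite -{1}(@addv_pi1_pi2 _ _ (alg_pow A i) (alg_pow A i.+1) z).
  by rewrite addrC addKr memv_pi2.
exact: subvP (addvSl _ _) _ Az.
Qed.

Lemma gr_class_next i z : z \in alg_pow A i.+1 -> gr_class i z = 0.
Proof.
move=> Az; apply: val_inj; rewrite /gr_class /= vsprojK ?memv_pi //.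
have /addv_pi1_pi2 : z \in (alg_pow A i + alg_pow A i.+1)%VS.
  exact: subvP (addvSr _ _) _ Az.
by rewrite (addv_pi2_id _ Az) -[RHS]add0r => /addIr.
Qed.

Lemma gr_class_eq i x y : x \in alg_pow A i -> y \in alg_pow A i ->
  (gr_class i x == gr_class i y) = (x - y \in alg_pow A i.+1).
Proof.
move=> Ax Ay; apply/eqP/idP => [eq_xy|/gr_class_next/eqP]; last first.
  by rewrite linearB subr_eq0 => /eqP.
have := memvB (vsval_gr_class Ax) (vsval_gr_class Ay).
by rewrite eq_xy opprB addrA subrK.
Qed.

Lemma vsval_grK i : cancel vsval (gr_class i).
Proof.
move=> u; apply: val_inj; rewrite /gr_class /= vsprojK ?memv_pi //.
by rewrite daddv_pi_id ?capv_diff ?subvsP.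
Qed.

(* The component at k : 'I_(\dim A) has degree k + 1; no degree is lost, since
   A^i = A^(i+1) for all i > \dim A. *)
Definition gr_sort : vectType K :=
  dirsum (fun k : 'I_(\dim {:A}) => gr_piece k.+1).

Definition gr_mul (x y : gr_sort) : gr_sort :=
  dirsum_of (fun k : 'I_(\dim {:A}) =>
    \sum_(i < \dim {:A}) \sum_(j < \dim {:A} | (i.+1 + j.+1 == k.+1)%N)
      gr_class k.+1 (vsval (x i) ** vsval (y j))).

End Graded.

Section GradedAlgebra.
Variables (K : fieldType) (A : assocAlg K).
Local Notation N := (\dim {:A}).
Implicit Types x y z : gr_sort A.

Fact gr_mul_is_bilinear : bilinear_for
  (GRing.Scale.Law.clone _ _ *:%R _) (GRing.Scale.Law.clone _ _ *:%R _)
  (@gr_mul K A).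
Proof.
split=> [z|z] a x y /=; apply/dirsumP => k; rewrite dirsumDE dirsumZE !dirsumE;
  rewrite scaler_sumr -big_split; apply: eq_bigr => i _ /=;
  rewrite scaler_sumr -big_split; apply: eq_bigr => j _ /=.
  by rewrite dirsumDE dirsumZE linearP /= linearPl linearP.
by rewrite dirsumDE dirsumZE !linearP.
Qed.

HB.instance Definition _ := bilinear_isBilinear.Build K
  (gr_sort A) (gr_sort A) (gr_sort A) _ _ (@gr_mul K A) gr_mul_is_bilinear.

Lemma gr_class_mull i k u v (m := (i + k)%N) : (0 < i)%N -> (0 < k)%N ->
  u \in alg_pow A i -> v \in alg_pow A k ->
  gr_class m (vsval (gr_class i u) ** v) = gr_class m (u ** v).
Proof.
move=> i0 k0 Au Av; apply/eqP; rewrite eq_sym gr_class_eq ?alg_powM //;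
  last exact: gr_piece_mem.
by rewrite -linearBl -addSn alg_powM ?vsval_gr_class.
Qed.

Lemma gr_class_mulr i k u v (m := (i + k)%N) : (0 < i)%N -> (0 < k)%N ->
  u \in alg_pow A i -> v \in alg_pow A k ->
  gr_class m (u ** vsval (gr_class k v)) = gr_class m (u ** v).
Proof.
move=> i0 k0 Au Av; apply/eqP; rewrite eq_sym gr_class_eq ?alg_powM //;
  last exact: gr_piece_mem.
by rewrite -linearBr -addnS alg_powM ?vsval_gr_class.
Qed.

Fact gr_mulA : associative (@gr_mul K A).
Proof.
move=> x y z; apply/dirsumP => l; rewrite !dirsumE.
pose T (i j k : 'I_N) := gr_class (A := A) l.+1
  (vsval (x i) ** vsval (y j) ** vsval (z k)).
pose S := \sum_(i < N) \sum_(j < N) \sum_(k < N)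
    if (i + j + k).+2 == l then T i j k else 0.
transitivity S; [|symmetry].
  apply: eq_bigr => i _; rewrite big_mkcond /=.
  transitivity (\sum_(m < N) \sum_(j < N) \sum_(k < N)
    if ((i + m).+1 == l) && ((j + k).+1 == m) then T i j k else 0).
    apply: eq_bigr => m _; rewrite addSn addnS eqSS.
    case: eqP => [im|_]; last by rewrite big1 // => j _; rewrite big1.
    rewrite dirsumE linear_sum linear_sumr linear_sum; apply: eq_bigr => j _.
    rewrite linear_sum linear_sumr linear_sum big_mkcond; apply: eq_bigr => k _.
    rewrite addSn addnS eqSS /=; case: eqP => // jk.
    have ->: m.+1 = (j.+1 + k.+1)%N by rewrite addSn addnS jk.
    have El : l.+1 = (i.+1 + (j.+1 + k.+1))%N.
      by rewrite -im -jk !(addSn, addnS).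
    rewrite /T El gr_class_mulr ?alg_mulA ?alg_powM ?gr_piece_mem //.
  rewrite exchange_big; apply: eq_bigr => j _.
  rewrite exchange_big; apply: eq_bigr => k _ /=.
  rewrite -big_mkcond /=; case: eqP => [ijk|n_ijk].
    have ltN: ((j + k).+1 < N)%N.
      by apply: leq_trans (ltn_ord l); rewrite -ijk -addnA !ltnS leqW ?leq_addl.
    rewrite (big_pred1 (Ordinal ltN)) // => m /=; rewrite -val_eqE /= [RHS]eq_sym.
    case: ((j + k).+1 =P m) => [<-|]; last by rewrite andbF.
    by rewrite andbT -ijk !addnS addnA eqxx.
  by rewrite big_pred0 // => m; apply/andP => -[/eqP im /eqP jk];
     case: n_ijk; rewrite -im -jk addnS addnA.
transitivity (\sum_(m < N) \sum_(k < N) \sum_(i < N) \sum_(j < N)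
    if ((m + k).+1 == l) && ((i + j).+1 == m) then T i j k else 0).
  apply: eq_bigr => m _; rewrite big_mkcond; apply: eq_bigr => k _.
  rewrite addSn addnS eqSS.
  case: eqP => [mk|_]; last by rewrite big1 // => i _; rewrite big1.
  rewrite dirsumE linear_sum linear_sumlz linear_sum; apply: eq_bigr => i _.
  rewrite linear_sum linear_sumlz linear_sum big_mkcond; apply: eq_bigr => j _.
  rewrite addSn addnS eqSS /=; case: eqP => // ij.
  have ->: m.+1 = (i.+1 + j.+1)%N by rewrite addSn addnS ij.
  have El : l.+1 = (i.+1 + j.+1 + k.+1)%N.
    by rewrite -mk -ij !(addSn, addnS).
  by rewrite /T El gr_class_mull ?alg_powM ?gr_piece_mem.
under eq_bigr => m _.
  rewrite exchange_big; under eq_bigr do rewrite exchange_big.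
  over.
rewrite exchange_big; apply: eq_bigr => i _.
rewrite exchange_big; apply: eq_bigr => j _.
rewrite exchange_big; apply: eq_bigr => k _ /=.
rewrite -big_mkcond /=; case: eqP => [ijk|n_ijk].
  have ltN: ((i + j).+1 < N)%N.
    by apply: leq_trans (ltn_ord l); rewrite -ijk !ltnS leqW ?leq_addr.
  rewrite (big_pred1 (Ordinal ltN)) // => m /=; rewrite -val_eqE /= [RHS]eq_sym.
  case: ((i + j).+1 =P m) => [<-|]; last by rewrite andbF.
  by rewrite andbT -ijk !addSn eqxx.
by rewrite big_pred0 // => m; apply/andP => -[/eqP mk /eqP ij];
   case: n_ijk; rewrite -mk -ij addSn.
Qed.

Definition gr_alg : assocAlg K := @AssocAlg K (gr_sort A) (@gr_mul K A) gr_mulA.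

Definition gr_homog (i : nat) (x : gr_alg) : Prop :=
  forall k : 'I_N, k.+1 != i -> (x : gr_sort A) k = 0.

Definition naturally_graded : Prop := alg_iso gr_alg A.

End GradedAlgebra.

(* f^j (v i), for i < size s and j < s_i, is a Jordan basis for f, with one
   block of size s_i and eigenvalue 0 for each i. *)
Definition jordan_blocks (K : fieldType) (V : vectType K) (f : V -> V)
    (s : seq nat) : Prop :=
  [/\ sorted geq s, all (leq 1) s
    & exists v : nat -> V,
        basis_of {:V} [seq iter j f (v i) | i <- iota 0 (size s),
                                            j <- iota 0 (nth 0%N s i)]
        /\ forall i, (i < size s)%N -> iter (nth 0%N s i) f (v i) = 0].

Definition char_seq (K : fieldType) (A : assocAlg K) (s : seq nat) : Prop :=
  (exists2 x : A, x \notin alg_pow A 2 & jordan_blocks (alg_mul A x) s)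
  /\ forall (x : A) (s' : seq nat), x \notin alg_pow A 2 ->
       jordan_blocks (alg_mul A x) s' -> (s' <= s :> seqlexi nat)%O.

Definition two_filiform (K : fieldType) (A : assocAlg K) : Prop :=
  char_seq A [:: \dim {:A} - 2; 1; 1]%N.

Section AlgebraSum.
Variables (K : fieldType) (A B : assocAlg K).

Definition alg_sum_mul (x y : A * B) : A * B := (x.1 ** y.1, x.2 ** y.2).

Fact alg_sum_mul_is_bilinear : bilinear_for
  (GRing.Scale.Law.clone _ _ *:%R _) (GRing.Scale.Law.clone _ _ *:%R _)
  alg_sum_mul.
Proof.
by split=> [z|z] a x y; rewrite /alg_sum_mul /= ?linearPl ?linearPr.
Qed.

HB.instance Definition _ := bilinear_isBilinear.Build K
  (A * B)%type (A * B)%type (A * B)%type _ _ alg_sum_mul alg_sum_mul_is_bilinear.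

Fact alg_sum_mulA : associative alg_sum_mul.
Proof. by move=> x y z; rewrite /alg_sum_mul /= !alg_mulA. Qed.

Definition alg_sum : assocAlg K :=
  @AssocAlg K (A * B)%type alg_sum_mul alg_sum_mulA.

End AlgebraSum.

Definition alg_split (K : fieldType) (A : assocAlg K) : Prop :=
  exists B1 B2 : assocAlg K,
    [/\ (0 < \dim {:B1})%N, (0 < \dim {:B2})%N & alg_iso A (alg_sum B1 B2)].

(* An identification of A with gr A being part of the notion, the homogeneous
   basis is taken in gr A. The basis vector e_i is [e i], for 1 <= i <= n - 2. *)
Definition has_type_mu (K : fieldType) (A : assocAlg K) (t1 t2 : nat) : Prop :=
  let n := \dim {:A} in
  (1 <= t1 <= t2)%N /\
  exists (e : nat -> gr_alg A) (f1 f2 : gr_alg A),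
    [/\ basis_of {:gr_alg A} ([seq e i | i <- iota 1 (n - 2)] ++ [:: f1; f2]),
        forall i, (1 <= i <= n - 2)%N -> gr_homog i (e i),
        gr_homog t1 f1 /\ gr_homog t2 f2,
        forall i j, (1 <= i <= n - 2)%N -> (1 <= j <= n - 2)%N ->
          e i ** e j = if (i + j <= n - 2)%N then e (i + j)%N else 0
      & forall k, (1 <= k <= n - 2)%N -> e k ** f1 = 0 /\ e k ** f2 = 0].

Section Mu21.
Variables (K : fieldType) (n : nat).
Local Notation V := 'rV[K]_n.

(* e_1, ..., e_n is the standard basis; the other indices give 0. *)
Definition mu21_e (k : nat) : V := \row_(j < n) (j.+1 == k)%:R.

Definition mu21_table (i j : nat) : V :=
  if (i + j <= n - 2)%N then mu21_e (i + j)
  else if (i == n - 1)%N && (j == 1)%N then mu21_e n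
  else 0.

Definition mu21_mul (u v : V) : V :=
  \sum_(i < n) \sum_(j < n) (u 0 i * v 0 j) *: mu21_table i.+1 j.+1.

Fact mu21_mul_is_bilinear : bilinear_for
  (GRing.Scale.Law.clone _ _ *:%R _) (GRing.Scale.Law.clone _ _ *:%R _)
  mu21_mul.
Proof.
split=> [w|w] a u v /=; rewrite /mu21_mul scaler_sumr -big_split;
  apply: eq_bigr => i _; rewrite scaler_sumr -big_split;
  apply: eq_bigr => j _ /=; rewrite !mxE scalerA -scalerDl.
  by rewrite mulrDl mulrA.
by rewrite mulrDr mulrCA.
Qed.

HB.instance Definition _ := bilinear_isBilinear.Build K
  V V V _ _ mu21_mul mu21_mul_is_bilinear.

Lemma mu21_mul_e i j : (1 <= i <= n)%N -> (1 <= j <= n)%N ->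
  mu21_mul (mu21_e i) (mu21_e j) = mu21_table i j.
Proof.
case: i j => // i [//|j] lt_in lt_jn.
rewrite /mu21_mul (bigD1 (Ordinal lt_in)) //= [X in _ + X]big1 ?addr0.
  rewrite (bigD1 (Ordinal lt_jn)) //= [X in _ + X]big1 ?addr0.
    by rewrite !mxE !eqxx mulr1 scale1r.
  move=> k; rewrite -val_eqE /= => ne_kj.
  by rewrite !mxE !eqSS (negPf ne_kj) mulr0 scale0r.
move=> k; rewrite -val_eqE /= => ne_ki; rewrite big1 // => l _.
by rewrite !mxE !eqSS (negPf ne_ki) mul0r scale0r.
Qed.

Lemma row_sum_e (u : V) : u = \sum_(i < n) u 0 i *: mu21_e i.+1.
Proof.
rewrite [LHS]row_sum_delta; apply: eq_bigr => i _.
suff -> : mu21_e i.+1 = delta_mx 0 i by [].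
by apply/rowP => j; rewrite !mxE eqxx eqSS.
Qed.

Lemma mu21_eM i j k : (1 <= i <= n)%N -> (1 <= j <= n)%N -> (1 <= k <= n)%N ->
  mu21_mul (mu21_e i) (mu21_table j k) = mu21_mul (mu21_table i j) (mu21_e k).
Proof.
move=> hi hj hk.
have tab a b : mu21_table a b =
    if (a + b <= n - 2)%N then mu21_e (a + b)
    else if (a == n - 1)%N && (b == 1)%N then mu21_e n else 0 by [].
rewrite (tab j k) (tab i j).
case: leqP => hjk; [|case: andP => [[/eqP ? /eqP ?]|hjk']];
  (case: leqP => hij; [|case: andP => [[/eqP ? /eqP ?]|hij']]);
  rewrite ?linear0l ?linear0r ?mu21_mul_e ?tab //; try lia;
  rewrite ?addnA; repeat (case: leqP => ? //; try lia);
  repeat (case: andP => [[/eqP ? /eqP ?]|?] //; try lia).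
Qed.

Lemma bilinear_assoc (f : {bilinear V -> V -> V}) :
  (forall i j k : 'I_n, f (mu21_e i.+1) (f (mu21_e j.+1) (mu21_e k.+1)) =
                        f (f (mu21_e i.+1) (mu21_e j.+1)) (mu21_e k.+1)) ->
  associative f.
Proof.
move=> fA u v w; rewrite (row_sum_e u) !linear_sumlz; apply: eq_bigr => i _.
rewrite !linearZl_LR /=; congr (_ *: _).
rewrite (row_sum_e v) linear_sumlz !linear_sumr linear_sumlz.
apply: eq_bigr => j _; rewrite linearZl_LR !linearZr_LR linearZl_LR /=.
congr (_ *: _).
rewrite (row_sum_e w) !linear_sumr; apply: eq_bigr => k _.
by rewrite !linearZr_LR /= fA.
Qed.

Fact mu21_mulA : associative mu21_mul.
Proof.
apply: bilinear_assoc => i j k /=.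
by rewrite !mu21_mul_e ?ltn_ord // mu21_eM ?ltn_ord.
Qed.

Definition mu21 : assocAlg K := @AssocAlg K V mu21_mul mu21_mulA.

End Mu21.

(* Main.v *)
(* In gr A the product f1 e1 has degree 2, hence equals a e2 + b f2; since
   e1 (f1 e1) = (e1 f1) e1 = 0 and e1 e2 = e3 <> 0, a = 0. In the same way
   f1 f1 = d f2, while f2 e1, f1 f2 and f2 f1, of degree 3, vanish. If b = d = 0,
   then A^2 is too small for A / A^2, which is the degree 1 part <e1, f1>, to have
   dimension 2. If d <> 0, then L_(e1 + f1) has Jordan blocks of sizes (n - 2, 2),
   against 2-filiformity. So d = 0 and b <> 0, and replacing f2 with b f2 gives
   the table of mu_(2,1)^n. *)
Require Import Defs.
From HB Require Import structures.
From mathcomp Require Import all_boot all_order all_algebra.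
From mathcomp Require Import zify.
From mathcomp Require Import reals complex.
Local Open Scope ring_scope.
Local Open Scope complex_scope.

Import Order.TTheory GRing.Theory.

Lemma in_map_cat2 (T : eqType) (m : nat) (e : nat -> T) (y z : T) (P : T -> Prop) :
  (forall i, (1 <= i <= m)%N -> P (e i)) -> P y -> P z ->
  forall x, x \in [seq e i | i <- iota 1 m] ++ [:: y; z] -> P x.
Proof.
move=> Pe Py Pz x; rewrite mem_cat !inE => /or3P[/mapP[j]|/eqP->|/eqP->] //.
by rewrite mem_iota add1n ltnS => hi ->; apply: Pe.
Qed.

Section Algebras.
Set Implicit Arguments.
Unset Strict Implicit.
Unset Printing Implicit Defensive.
Local Open Scope alg_scope.
Variable K : fieldType.
Implicit Types A B : assocAlg K.

Lemma alg_pow2_sub A (X : seq A) (W : {vspace A}) :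
  <<X>>%VS = fullv -> {in X &, forall x y, x ** y \in W} ->
  (alg_pow A 2 <= W)%VS.
Proof.
move=> spX XW; rewrite alg_powS // big_nat1; apply/alg_prodvP => u v _ _.
have mem_span w : w \in <<in_tuple X>>%VS by rewrite spX memvf.
rewrite (coord_span (mem_span u)) (coord_span (mem_span v)).
rewrite linear_sumlz; apply: memv_suml => i _.
rewrite linear_sumr; apply: memv_suml => j _.
rewrite linearZl_LR linearZr_LR; do 2!apply: memvZ.
by apply: XW; rewrite mem_nth.
Qed.

(** * Homogeneous elements and components of the graded algebra *)

Section Grading.
Variable A : assocAlg K.

Lemma gr_homogM i j (x y : gr_alg A) :
  gr_homog i x -> gr_homog j y -> gr_homog (i + j) (x ** y).
Proof.
move=> hx hy k nk; rewrite dirsumE big1 // => p _; rewrite big1 // => q /eqP pq.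
case: (eqVneq p.+1 i) => [pi|/hx ->]; last by rewrite linear0 ?linear0l ?linear0.
case: (eqVneq q.+1 j) => [qj|/hy ->]; last by rewrite linear0 ?linear0r ?linear0.
by rewrite -pi -qj pq eqxx in nk.
Qed.

Definition gr_proj (k : nat) (x : gr_alg A) : gr_alg A :=
  dirsum_of (fun i : 'I_(\dim {:A}) =>
    if i.+1 == k then (x : gr_sort A) i else 0).

Fact gr_proj_is_linear k : linear (gr_proj k).
Proof.
move=> a x y; apply/dirsumP => i; rewrite dirsumDE dirsumZE !dirsumE.
by case: ifP => _; rewrite ?dirsumDE ?dirsumZE // scaler0 addr0.
Qed.
HB.instance Definition _ k := GRing.isLinear.Build K (gr_alg A) (gr_alg A) _
  (gr_proj k) (gr_proj_is_linear k).

Lemma gr_proj_homog i k x :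
  gr_homog i x -> gr_proj k x = if i == k then x else 0.
Proof.
move=> hx; apply/dirsumP => j; rewrite dirsumE.
case: (eqVneq i k) => [<-|nik]; case: eqVneq => [jk|] //.
- by move/hx ->.
- by rewrite dirsum0E hx // jk eq_sym.
- by rewrite dirsum0E.
Qed.

(** A homogeneous element is fixed by the projection onto its degree, so it lies in the span of the
    projected generators. *)
Lemma gr_homog_span (X : seq (gr_alg A)) (W : {vspace gr_alg A}) k x :
  <<X>>%VS = fullv -> {in X, forall y, gr_proj k y \in W} ->
  gr_homog k x -> x \in W.
Proof.
move=> spX XW hx; have <- : linfun (gr_proj k) x = x.
  by rewrite lfunE /= (gr_proj_homog k hx) eqxx.
have /(memv_img (linfun (gr_proj k))) : x \in <<X>>%VS by rewrite spX memvf.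
rewrite limg_span; apply/subvP/span_subvP => _ /mapP[y Xy ->].
by rewrite lfunE; apply: XW.
Qed.

Lemma dim_gr_piece1 : (\dim {: gr_piece A 1} + \dim (alg_pow A 2) = \dim {:A})%N.
Proof.
have -> : \dim {: gr_piece A 1} = \dim (alg_pow A 1 :\: alg_pow A 2)%VS.
  by rewrite dimvf.
by rewrite addnC -[RHS](dimv_cap_compl {:A} (alg_pow A 2)) alg_pow1 capfv.
Qed.

(** Unlike [gr_proj], this lands in the quotient piece itself, whose dimension can then be bounded
    through generators. *)
Definition gr_comp (k : 'I_(\dim {:A})) (x : gr_alg A) : gr_piece A k.+1 :=
  (x : gr_sort A) k.

Fact gr_comp_is_linear k : linear (gr_comp k).
Proof. by move=> a x y; rewrite /gr_comp dirsumDE dirsumZE. Qed.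
HB.instance Definition _ (k : 'I_(\dim {:A})) :=
  GRing.isLinear.Build K (gr_alg A) (gr_piece A k.+1)
  _ (gr_comp k) (gr_comp_is_linear k).

Lemma limg_gr_comp (k : 'I_(\dim {:A})) : limg (linfun (gr_comp k)) = fullv.
Proof.
apply/eqP; rewrite eqEsubv subvf; apply/subvP => u _.
(* The preimage carries the class of [u] in every degree, which avoids casts between the dependent
   pieces; at index [k] the class is [u] itself. *)
apply/memv_imgP; exists (dirsum_of (fun i : 'I_(\dim {:A}) =>
  gr_class (A := A) i.+1 (vsval u))); first exact: memvf.
by rewrite lfunE /= /gr_comp dirsumE vsval_grK.
Qed.

Lemma dim_gr_piece_le (k : 'I_(\dim {:A})) (X : seq (gr_alg A)) (W : {vspace gr_piece A k.+1}) :
  <<X>>%VS = fullv -> {in X, forall y, gr_comp k y \in W} ->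
  (\dim {: gr_piece A k.+1} <= \dim W)%N.
Proof.
move=> spX XW; rewrite -limg_gr_comp -spX limg_span; apply: dimvS.
by apply/span_subvP => _ /mapP[y Xy ->]; rewrite lfunE; apply: XW.
Qed.

End Grading.

(** * Recognising [mu21] from a spanning family with its table *)

Lemma alg_iso_mu21 A (n : nat) (B : nat -> A) :
  \dim {:A} = n -> <<[tuple B i.+1 | i < n]>>%VS = fullv ->
  (forall i j, (1 <= i <= n)%N -> (1 <= j <= n)%N ->
    B i ** B j = if (i + j <= n - 2)%N then B (i + j)%N
                 else if (i == n - 1)%N && (j == 1)%N then B n else 0) ->
  alg_iso A (mu21 K n).
Proof.
set X := [tuple _ | i < n] => dimA spX BM.
have basX : basis_of {:A} X by rewrite basisEdim spX subvv size_tuple dimA /=.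
have freeX := basis_free basX.
have nthX (i : 'I_n) : X`_i = B i.+1 by rewrite -tnth_nth tnth_mktuple.
pose f (x : A) : 'rV[K]_n := \row_i coord X i x.
have fL : linear f by move=> a x y; apply/rowP => i; rewrite !mxE linearP.
pose fM := GRing.isLinear.Build K A 'rV[K]_n _ f fL.
pose fl : {linear A -> mu21 K n} := HB.pack f fM.
have fB k : (1 <= k <= n)%N -> f (B k) = mu21_e K n k.
  case: k => // k ltkn; apply/rowP => i; rewrite !mxE.
  by rewrite -(nthX (Ordinal ltkn)) coord_free // eqSS eq_sym -val_eqE.
exists fl; split.
  exists (fun u : 'rV[K]_n => \sum_(i < n) u 0 i *: X`_i) => [x|u] /=.
    by rewrite [RHS](coord_basis basX (memvf x)); apply: eq_bigr => i _; rewrite mxE.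
  by apply/rowP => i; rewrite mxE coord_sum_free.
(* By bilinearity, multiplicativity reduces to the products of basis vectors. *)
move=> x y; rewrite [in LHS](coord_basis basX (memvf x)).
rewrite [in LHS](coord_basis basX (memvf y)).
rewrite linear_sumlz linear_sum; apply: eq_bigr => i _.
rewrite linear_sumr linear_sum; apply: eq_bigr => j _.
rewrite linearZl_LR linearZr_LR (linearZ_LR fl) (linearZ_LR fl) scalerA !mxE /= !nthX BM ?ltn_ord //.
congr (_ *: _); rewrite /mu21_table.
case: ifP => [le_ij|_]; first by rewrite fB //; lia.
by case: ifP => [_|_]; [rewrite fB //; have := ltn_ord i; lia | apply: raddf0 fl].
Qed.

(** * The multiplication table forced by the type *)

(** The scalar [c] is kept because for [m = 4] the product [e 1 ** e 4] vanishes, so left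
    multiplication by [e 1] cannot exclude it. *)
Record mu12_table A (m : nat) (e : nat -> A) (f1 f2 : A) (b c d : K) : Prop := {
  tab_dim : \dim {:A} = m.+2;
  tab_span : <<[seq e i | i <- iota 1 m] ++ [:: f1; f2]>>%VS = fullv;
  tab_ee : forall i j, (1 <= i <= m)%N -> (1 <= j <= m)%N ->
    e i ** e j = if (i + j <= m)%N then e (i + j)%N else 0;
  tab_ef1 : forall i, (1 <= i <= m)%N -> e i ** f1 = 0;
  tab_ef2 : forall i, (1 <= i <= m)%N -> e i ** f2 = 0;
  tab_f1e1 : f1 ** e 1%N = b *: f2;
  tab_f1f1 : f1 ** f1 = d *: f2;
  tab_f1f2 : f1 ** f2 = 0;
  tab_f2e1 : f2 ** e 1%N = 0;
  tab_f2f1 : f2 ** f1 = 0;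
  tab_f2f2 : f2 ** f2 = c *: e 4
}.

(** Moves the table from the graded algebra to the original one, where the characteristic sequence
    is given. *)
Lemma mu12_table_iso A B (f : {linear A -> B}) m e f1 f2 b c d :
  bijective f -> (forall x y, f (x ** y) = f x ** f y) ->
  \dim {:B} = m.+2 -> mu12_table m e f1 f2 b c d ->
  mu12_table m (f \o e) (f f1) (f f2) b c d.
Proof.
move=> [g fK gK] fM dimB [_ spX ee ef1 ef2 f1e1 f1f1 f1f2 f2e1 f2f1 f2f2].
split=> //; rewrite /= -?fM.
- have -> : [seq (f \o e) i | i <- iota 1 m] ++ [:: f f1; f f2] =
      [seq linfun f x | x <- [seq e i | i <- iota 1 m] ++ [:: f1; f2]].
    rewrite map_cat -map_comp /= !lfunE; congr (_ ++ _).
    by apply: eq_map => i /=; rewrite lfunE.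
  rewrite -limg_span spX; apply/eqP; rewrite eqEsubv subvf; apply/subvP => y _.
  by apply/memv_imgP; exists (g y); rewrite ?memvf // lfunE /= gK.
- by move=> i j hi hj; rewrite -fM ee //; case: ifP; rewrite ?linear0.
- by move=> i hi; rewrite -fM ef1 ?linear0.
- by move=> i hi; rewrite -fM ef2 ?linear0.
- by rewrite f1e1 linearZ.
- by rewrite f1f1 linearZ.
- by rewrite f1f2 linear0.
- by rewrite f2e1 linear0.
- by rewrite f2f1 linear0.
- by rewrite f2f2 linearZ.
Qed.

Lemma type_mu12_table A (n : nat) : \dim {:A} = n -> (5 < n)%N -> has_type_mu A 1 2 ->
  (n - 2 <= \dim (alg_pow A 2))%N /\
  exists (e : nat -> gr_alg A) f1 f2 b c d, mu12_table (n - 2) e f1 f2 b c d.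
Proof.
move=> dimA n5; rewrite /has_type_mu dimA => -[_ [e [f1 [f2]]]].
set m := (n - 2)%N => -[basX eH [f1H f2H] ee ef].
set X := _ ++ _ in basX.
have spX := span_basis basX.
have XP := @in_map_cat2 _ m e f1 f2.
have e_neq0 i : (1 <= i <= m)%N -> e i != 0.
  move=> hi; apply: (free_not0 (basis_free basX)).
  by rewrite mem_cat map_f ?mem_iota ?add1n ?ltnS.
have H2 x : gr_homog 2 x -> exists a b, x = a *: e 2%N + b *: f2.
  move=> hx; have /memv_addP[_ /vlineP[a ->] [_ /vlineP[b ->] ->]] :
      x \in (<[e 2%N]> + <[f2]>)%VS.
    apply: (gr_homog_span spX _ hx); apply: XP => [i hi||].
    - rewrite (gr_proj_homog 2 (eH i hi)); case: eqP => [->|_]; last exact: mem0v.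
      exact: subvP (addvSl _ _) _ (memv_line _).
    - by rewrite (gr_proj_homog 2 f1H) mem0v.
    - rewrite (gr_proj_homog 2 f2H) /=.
      exact: subvP (addvSr _ _) _ (memv_line _).
  by exists a, b.
have Hk k x : (2 < k <= m)%N -> gr_homog k x -> exists a, x = a *: e k.
  move=> hk hx; apply/vlineP; apply: (gr_homog_span spX _ hx); apply: XP => [i hi||].
  - rewrite (gr_proj_homog k (eH i hi)); case: eqP => [->|_]; last exact: mem0v.
    exact: memv_line.
  - by rewrite (gr_proj_homog k f1H); case: eqP => [?|_]; [lia | apply: mem0v].
  - by rewrite (gr_proj_homog k f2H); case: eqP => [?|_]; [lia | apply: mem0v].
have e1H : gr_homog 1 (e 1%N) by apply: eH; lia.
have ef1 : e 1%N ** f1 = 0 by apply: (ef 1%N _).1; lia.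
have ef2 : e 1%N ** f2 = 0 by apply: (ef 1%N _).2; lia.
(* [e 1 ** x = 0] kills the components of [x] along [e 2] and [e 3], because
   [e 1 ** e i = e i.+1 != 0] for [i < m]. *)
have H2_0 x : gr_homog 2 x -> e 1%N ** x = 0 -> exists b, x = b *: f2.
  move=> /H2[a [b ->]]; rewrite linearDr /= !linearZr_LR /= ef2 scaler0 addr0.
  rewrite ee ?ifT; try lia.
  move/eqP; rewrite scaler_eq0 (negPf (e_neq0 _ _)); last lia.
  by rewrite orbF => /eqP->; exists b; rewrite scale0r add0r.
have H3_0 x : gr_homog 3 x -> e 1%N ** x = 0 -> x = 0.
  move=> /Hk[|a ->]; first lia.
  rewrite linearZr_LR /= ee ?ifT; try lia.
  move/eqP; rewrite scaler_eq0 (negPf (e_neq0 _ _)); last lia.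
  by rewrite orbF => /eqP->; rewrite scale0r.
split.
  have ltN : (0 < \dim {:A})%N by lia.
  (* Index 0 holds degree 1, that is [A / A^2]. Only [e 1] and [f1] can have a nonzero component
     there, so this quotient has dimension at most 2. *)
  have := dim_gr_piece1 A; pose k0 := Ordinal ltN.
  have : (\dim {: gr_piece A 1} <=
      \dim (<[gr_comp k0 (e 1%N)]> + <[gr_comp k0 f1]>)%VS)%N.
    apply: (dim_gr_piece_le (k := k0) spX); apply: XP => [i hi||].
    - case: (eqVneq i 1%N) => [->|ne_i1].
        exact: subvP (addvSl _ _) _ (memv_line _).
      by rewrite /gr_comp (eH i hi) ?mem0v // eq_sym.
    - exact: subvP (addvSr _ _) _ (memv_line _).
    - by rewrite /gr_comp f2H ?mem0v.
  have := (dimv_add_leqif <[gr_comp k0 (e 1%N)]> <[gr_comp k0 f1]>).1.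
  by rewrite !dim_vline; move: (_ != 0) (_ != 0) => [] []; lia.
have [b f1e1] : exists b, f1 ** e 1%N = b *: f2.
  by apply: H2_0; [apply: (gr_homogM f1H e1H) | rewrite alg_mulA ef1 linear0l].
have [d f1f1] : exists d, f1 ** f1 = d *: f2.
  by apply: H2_0; [apply: (gr_homogM f1H f1H) | rewrite alg_mulA ef1 linear0l].
have [c f2f2] : exists c, f2 ** f2 = c *: e 4.
  by apply: Hk; [lia | apply: (gr_homogM f2H f2H)].
exists e, f1, f2, b, c, d; split=> //.
- by rewrite (size_basis basX) addn2.
- by move=> i /ef[].
- by move=> i /ef[].
- by apply: H3_0; [apply: (gr_homogM f1H f2H) | rewrite alg_mulA ef1 linear0l].
- by apply: H3_0; [apply: (gr_homogM f2H e1H) | rewrite alg_mulA ef2 linear0l].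
- by apply: H3_0; [apply: (gr_homogM f2H f1H) | rewrite alg_mulA ef2 linear0l].
Qed.

(** * Constraints on the scalars of the table, and the final change of basis *)

Section Table.
Variables (A : assocAlg K) (m : nat) (e : nat -> A) (f1 f2 : A) (b c d : K).
Hypothesis tab : mu12_table m e f1 f2 b c d.
Hypothesis m_gt3 : (3 < m)%N.
Local Notation X := ([seq e i | i <- iota 1 m] ++ [:: f1; f2]).

Let tab_basis : basis_of {:A} X.
Proof.
by rewrite basisEdim (tab_span tab) subvv (tab_dim tab) size_cat size_map
  size_iota addn2 /=.
Qed.

Let tab_eS i : (1 < i <= m)%N -> e 1%N ** e i.-1 = e i.
Proof.
by case: i => [|[|i]] // hi; rewrite (tab_ee tab) ?ifT //; lia.
Qed.

(** For [i > 1], associativity gives [f2 ** e i = (f2 ** e 1) ** e i.-1]; the same device applied to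
    [f1] leads back to [f2]. *)
Let tab_f2e i : (1 <= i <= m)%N -> f2 ** e i = 0.
Proof.
move=> hi; case: (eqVneq i 1%N) => [->|ne_i1]; first exact: tab_f2e1 tab.
by rewrite -tab_eS ?alg_mulA ?(tab_f2e1 tab) ?linear0l //; lia.
Qed.

Let tab_f1e i : (1 < i <= m)%N -> f1 ** e i = 0.
Proof.
move=> hi; rewrite -tab_eS // alg_mulA (tab_f1e1 tab) linearZl_LR /=.
by rewrite tab_f2e ?scaler0 //; lia.
Qed.

Lemma mu12_table_mul_sub (W : {vspace A}) :
  (forall i, (1 < i <= m)%N -> e i \in W) ->
  b *: f2 \in W -> d *: f2 \in W -> c *: e 4 \in W -> (alg_pow A 2 <= W)%VS.
Proof.
move=> We Wb Wd Wc; apply: alg_pow2_sub (tab_span tab) _ => x y Xx Xy.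
move: x Xx; apply: in_map_cat2 => [i hi||]; move: y Xy;
  apply: in_map_cat2 => [j hj||].
- by rewrite (tab_ee tab) //; case: ifP => [le_ij|_]; [apply: We; lia | apply: mem0v].
- by rewrite (tab_ef1 tab) // mem0v.
- by rewrite (tab_ef2 tab) // mem0v.
- case: (eqVneq j 1%N) => [->|ne_j1]; first by rewrite (tab_f1e1 tab).
  by rewrite tab_f1e ?mem0v //; lia.
- by rewrite (tab_f1f1 tab).
- by rewrite (tab_f1f2 tab) mem0v.
- by rewrite tab_f2e // mem0v.
- by rewrite (tab_f2f1 tab) mem0v.
- by rewrite (tab_f2f2 tab).
Qed.

(** Otherwise [A^2] lies in the span of [e 2, ..., e m], of dimension at most [m - 1]. *)
Lemma mu12_table_bd_neq0 : (m <= \dim (alg_pow A 2))%N -> (b != 0) || (d != 0).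
Proof.
move=> dimA2; rewrite -negb_and; apply/negP => /andP[/eqP b0 /eqP d0].
have : (alg_pow A 2 <= <<[seq e i | i <- iota 2 m.-1]>>)%VS.
  have We i : (1 < i <= m)%N -> e i \in <<[seq e i | i <- iota 2 m.-1]>>%VS.
    by move=> hi; apply/memv_span/map_f; rewrite mem_iota; lia.
  apply: mu12_table_mul_sub => //; rewrite ?b0 ?d0 ?scale0r ?mem0v //.
  by apply: memvZ; apply: We; lia.
move=> /dimvS; have := dim_span [seq e i | i <- iota 2 m.-1].
rewrite size_map size_iota; lia.
Qed.

(** Some [f1 ** x] is a nonzero multiple of [f2], with [x] equal to [e 1] or [f1], and
    [f2 ** f1 = 0]. *)
Lemma mu12_table_f2f2 : (b != 0) || (d != 0) -> f2 ** f2 = 0.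
Proof.
suff f2f2 k x : k != 0 -> f1 ** x = k *: f2 -> f2 ** f2 = 0.
  by case/orP => [b0|d0]; [apply: f2f2 b0 (tab_f1e1 tab) | apply: f2f2 d0 (tab_f1f1 tab)].
move=> k0 f1x; have -> : f2 ** f2 = k^-1 *: (f2 ** (f1 ** x)).
  by rewrite f1x linearZr_LR /= scalerA mulVf // scale1r.
by rewrite alg_mulA (tab_f2f1 tab) linear0l scaler0.
Qed.

(* With [d != 0], left multiplication by [e 1 + f1] has the Jordan chains
   [e 1, e 2 + b f2, e 3, ..., e m] and [f1, d f2], and (m, 2) > (m, 1, 1). *)
Lemma mu12_table_d0 : two_filiform A -> (m <= \dim (alg_pow A 2))%N -> d = 0.
Proof.
move=> [_ maxC] dimA2; apply/eqP; apply/negPn/negP => d0.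
have f2f2 : f2 ** f2 = 0 by apply: mu12_table_f2f2; rewrite d0 orbT.
pose x := e 1%N + f1.
have freeX := basis_free tab_basis.
have xA2 : x \notin alg_pow A 2.
  (* The [m] vectors of [Y] span a space containing [A^2]. If it contained [x], adding [f1] would
     recover [e 1], and [m + 1] vectors would span a space of dimension [m + 2]. *)
  pose Y := [seq e i | i <- iota 2 m.-1] ++ [:: f2].
  have Yf2 k : k *: f2 \in <<Y>>%VS.
    by apply/memvZ/memv_span; rewrite mem_cat inE eqxx orbT.
  have Ye i : (1 < i <= m)%N -> e i \in <<Y>>%VS.
    by move=> hi; apply/memv_span; rewrite mem_cat map_f // mem_iota; lia.
  have sub : (alg_pow A 2 <= <<Y>>)%VS.
    by apply: mu12_table_mul_sub => //; apply: memvZ; apply: Ye; lia.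
  apply/negP => /(subvP sub) Yx.
  have Y1 v : v \in <<Y>>%VS -> v \in <<f1 :: Y>>%VS.
    by rewrite span_cons; apply/subvP/addvSr.
  have Yf1 : f1 \in <<f1 :: Y>>%VS by apply: memv_span; rewrite inE eqxx.
  have : ({:A} <= <<f1 :: Y>>)%VS.
    rewrite -(tab_span tab); apply/span_subvP; apply: in_map_cat2 => [i hi||] //.
      case: (eqVneq i 1%N) => [->|ne_i1]; last by apply/Y1/Ye; lia.
      by rewrite -[e 1%N](addrK f1) memvB // Y1.
    by rewrite -[f2]scale1r Y1.
  move=> /dimvS; have := dim_span (f1 :: Y).
  by rewrite (tab_dim tab) /= size_cat size_map size_iota /=; lia.
have x_e1 : x ** e 1%N = e 2 + b *: f2.
  by rewrite linearDl /= (tab_f1e1 tab) (tab_ee tab) ?ifT //; lia.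
have x_e i : (1 < i <= m)%N -> x ** e i = if (i < m)%N then e i.+1 else 0.
  by move=> hi; rewrite linearDl /= tab_f1e // addr0 (tab_ee tab) //; lia.
have x_f1 : x ** f1 = d *: f2.
  by rewrite linearDl /= (tab_f1f1 tab) (tab_ef1 tab) ?add0r //; lia.
have x_f2 : x ** f2 = 0.
  by rewrite linearDl /= (tab_f1f2 tab) (tab_ef2 tab) ?add0r //; lia.
(* The term [b *: f2] occurs only in the second vector of the chain, since [x ** f2 = 0]. *)
have iterE j : (1 < j < m)%N -> iter j (alg_mul A x) (e 1%N) = e j.+1.
  case: j => [|[|j]] //; elim: j => [|j IHj] hj.
    by rewrite /= x_e1 linearDr /= linearZr_LR /= x_f2 scaler0 addr0 x_e ?ifT //; lia.
  by rewrite iterS IHj ?x_e ?ifT //; lia.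
suff : jordan_blocks (alg_mul A x) [:: m; 2]%N.
  move/(maxC _ _ xA2); rewrite (tab_dim tab) -[m.+2]addn2 addnK.
  by rewrite lexi_cons lexx /= lexi_cons.
split; [by rewrite /= andbT; lia | by rewrite /= andbT; lia |].
exists (fun i => if i == 0%N then e 1%N else f1); split; last first.
  case=> [|[|]] //= _; last by rewrite x_f1 linearZr_LR /= x_f2 scaler0.
  have -> : m = m.-1.+1 by lia.
  by rewrite iterS iterE ?x_e ?ifF //; lia.
rewrite /=; set Y := _ ++ _.
(* The two chains have [m + 2] vectors in all, so spanning suffices. As [d] is invertible, [f2]
   comes from [x ** f1], and then [e 2] from [x ** e 1]. *)
rewrite basisEdim (tab_dim tab) size_cat size_map size_iota addn2 leqnn andbT.
have Yf2 : f2 \in <<Y>>%VS.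
  have -> : f2 = d^-1 *: (x ** f1) by rewrite x_f1 scalerA mulVf ?scale1r.
  by apply/memvZ/memv_span; rewrite mem_cat !inE eqxx !orbT.
have Yiter j : (j < m)%N -> iter j (alg_mul A x) (e 1%N) \in <<Y>>%VS.
  move=> ltjm; apply: memv_span; rewrite mem_cat; apply/orP; left.
  by apply: (map_f (fun j => iter j (alg_mul A x) (e 1%N))); rewrite mem_iota.
rewrite -(tab_span tab); apply/span_subvP; apply: in_map_cat2 => //; last first.
  by apply: memv_span; rewrite mem_cat !inE eqxx !orbT.
case=> [|[|[|i]]] // hi.
- by apply: (Yiter 0%N); lia.
- rewrite -[e 2](addrK (b *: f2)) -x_e1; apply: memvB; last exact: memvZ.
  by apply: (Yiter 1%N); lia.
- by rewrite -iterE ?Yiter; lia.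
Qed.

Lemma mu12_table_iso_mu21 : b != 0 -> d = 0 -> alg_iso A (mu21 K m.+2).
Proof.
move=> b0 d0; have f2f2 : f2 ** f2 = 0 by apply: mu12_table_f2f2; rewrite b0.
(* Scaling the last vector by [b] turns [f1 ** e 1 = b *: f2] into the relation
   [B m.+1 ** B 1 = B m.+2] of [mu21]. *)
pose B k := if (k <= m)%N then e k else if k == m.+1 then f1 else b *: f2.
have Be k : (k <= m)%N -> B k = e k by rewrite /B => ->.
have B1 : B m.+1 = f1 by rewrite /B eqxx ltnn.
have B2 : B m.+2 = b *: f2 by rewrite /B !ifF //; lia.
apply: (alg_iso_mu21 (B := B)); first exact: tab_dim tab.
  apply/eqP; rewrite eqEsubv subvf -(tab_span tab) /=; apply/span_subvP.
  have BX k : (1 <= k <= m.+2)%N -> B k \in <<[tuple B i.+1 | i < m.+2]>>%VS.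
    case: k => // k ltk; apply: memv_span; apply/codomP.
    by exists (Ordinal ltk).
  apply: in_map_cat2 => [i hi||].
  - by rewrite -Be ?BX //; lia.
  - by rewrite -B1 BX //; lia.
  - by rewrite -(scalerK b0 f2) memvZ // -B2 BX //; lia.
have cases k : (1 <= k <= m.+2)%N -> [\/ (1 <= k <= m)%N, k = m.+1 | k = m.+2].
  by move=> hk; case: (ltngtP k m.+1) => ?; [apply: Or31|apply: Or33|apply: Or32]; lia.
move=> i j /cases[hi|->|->] /cases[hj|->|->]; rewrite ?B1 ?B2.
- rewrite (Be i) ?(Be j) ?(tab_ee tab) ?subn2 //=; try lia.
  by case: ifP => [le_ij|_]; rewrite ?Be // ifF //; lia.
- by rewrite (Be i) ?(tab_ef1 tab) ?ifF //; lia.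
- by rewrite (Be i) ?linearZr_LR /= ?(tab_ef2 tab) ?scaler0 ?ifF //; lia.
- rewrite ifF; last lia.
  case: (eqVneq j 1%N) => [->|ne_j1].
    by rewrite ifT ?Be ?(tab_f1e1 tab) //; lia.
  by rewrite ifF ?Be ?tab_f1e //; lia.
- by rewrite (tab_f1f1 tab) d0 scale0r !ifF //; lia.
- by rewrite linearZr_LR /= (tab_f1f2 tab) scaler0 !ifF //; lia.
- by rewrite linearZl_LR /= Be ?tab_f2e ?scaler0 ?ifF //; lia.
- by rewrite linearZl_LR /= (tab_f2f1 tab) scaler0 !ifF //; lia.
- by rewrite linearZl_LR linearZr_LR /= f2f2 !scaler0 !ifF //; lia.
Qed.

End Table.

End Algebras.

Theorem theorem4p4 (R : realType) (n : nat) (A : assocAlg R[i])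
    (n_gt5 : (5 < n)%N)
    (dimA : \dim {:A} = n)
    (nilA : alg_nilpotent A)
    (natA : naturally_graded A)
    (filA : two_filiform A)
    (nonsplitA : ~ alg_split A)
    (typeA : has_type_mu A 1 2) :
  alg_iso A (mu21 R[i] n).
Proof.
have [dimA2 [e [f1 [f2 [b [c [d tabG]]]]]]] := type_mu12_table dimA n_gt5 typeA.
have [f [f_bij fM]] := natA.
have mE : n = (n - 2).+2 by lia.
(* Natural gradedness brings the table into [A], where 2-filiformity gives [d = 0] and the dimension
   of [A^2] then gives [b != 0]. *)
have tab := mu12_table_iso f_bij fM (etrans dimA mE) tabG.
have m_gt3 : (3 < n - 2)%N by lia.
have d0 := mu12_table_d0 tab m_gt3 filA dimA2.
have := mu12_table_bd_neq0 tab m_gt3 dimA2; rewrite d0 eqxx orbF => b0.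
by rewrite mE; apply: mu12_table_iso_mu21 tab m_gt3 b0 d0.
Qed.
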